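(* For any integer $r\ge 1$, we have the identity of formal power series $$\sum_{n,k=0}^{\infty} T_r(n,k)\,\frac{u^n}{n!}\, y^k \;=\; \prod_{j=1}^{\infty} (1-u^j)^{-y\lambda_{r-1}(j)}.$$ In particular, taking $y=1$, $$\sum_{n=0}^{\infty} T_r(n)\,\frac{u^n}{n!} \;=\; \prod_{j=1}^{\infty} (1-u^j)^{-\lambda_{r-1}(j)}.$$
   Context: $S_n$ denotes the symmetric group on $[n]=\{1,\ldots,n\}$ (with $[0]=\emptyset$ and $S_0$ trivial). For integers $r\ge 0$ and $n\ge 0$, $T_r(n)$ denotes the number of ordered $r$-tuples $(g_1,\ldots,g_r)$ of elements of $S_n$ such that $g_ig_j=g_jg_i$ for all $i,j$; equivalently $T_r(n)=|\mathrm{Hom}(\mathbf{Z}^r,S_n)|$, the number of actions of the group $\mathbf{Z}^r$ on the set $[n]$. For $k\ge 0$, $T_r(n,k)$ denotes the number of actions of $\mathbf{Z}^r$ on $[n]$ having exactly $k$ orbits (the unique action on the empty set has $0$ orbits). For $r\ge 1$ and $n\ge 1$, $\lambda_r(n)$ denotes the number of subgroups of $\mathbf{Z}^r$ of index $n$; for $r=0$, by convention $\lambda_0(n)=1$ if $n=1$ and $\lambda_0(n)=0$ otherwise. The series are formal power series in $u$ with coefficients in $\mathbf{Q}[y]$ (respectively $\mathbf{Q}$), where $(1-u^j)^{-a}$ means $\exp(-a\log(1-u^j))=\exp\bigl(a\sum_{m\ge 1}u^{jm}/m\bigr)$. *)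

(* Defs.v *)
From mathcomp Require Import all_boot all_order all_algebra all_fingroup.
From mathcomp Require Import finmap all_classical.

Set Implicit Arguments.
Unset Strict Implicit.
Unset Printing Implicit Defensive.

Import GRing.Theory.
Local Open Scope ring_scope.

(** Formal power series in [u]: [f n] is the coefficient of [u ^ n].  The
    operations involving denominators are meant for rings in which every
    [m.+1%:R] is invertible, such as [rat] and [{poly rat}]. *)

Definition fps (R : comUnitRingType) : Type := nat -> R.

Definition fps_one {R : comUnitRingType} : fps R := fun n => (n == 0%N)%:R.

Definition fps_mul {R : comUnitRingType} (f g : fps R) : fps R :=
  fun n => \sum_(i < n.+1) f i * g (n - i)%N.

Definition fps_pow {R : comUnitRingType} (f : fps R) (k : nat) : fps R :=
  iter k (fps_mul f) fps_one.

(** [exp f], for [f] without constant term: the powers [f ^ k] with [k > n] then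
    do not contribute to the coefficient of [u ^ n] (see [fps_pow_small]). *)
Definition fps_exp {R : comUnitRingType} (f : fps R) : fps R :=
  fun n => \sum_(k < n.+1) (k`!%:R)^-1 * fps_pow f k n.

Lemma fps_pow_small (R : comUnitRingType) (f : fps R) (k n : nat) :
  f 0%N = 0 -> (n < k)%N -> fps_pow f k n = 0.
Proof.
move=> f0; elim: k n => [//|k IHk] n ltnk.
rewrite /fps_pow iterS /fps_mul big1 // => -[[|i] lti] _ /=.
  by rewrite f0 mul0r.
rewrite [iter _ _ _ _]IHk ?mulr0 //.
by rewrite ltn_subLR // addSn ltnS (leq_trans _ (leq_addl _ _)).
Qed.

(** [- a * log (1 - u ^ j) = a * \sum_(m >= 1) u ^ (j * m) / m], for [j >= 1]:
    the equation [j * m = n] then forces [m <= n]. *)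
Definition fps_neglog {R : comUnitRingType} (j : nat) (a : R) : fps R :=
  fun n => \sum_(1 <= m < n.+1 | (j * m == n)%N) a / m%:R.

(** [(1 - u ^ j) ^ (- a)] *)
Definition fps_geompow {R : comUnitRingType} (j : nat) (a : R) : fps R :=
  fps_exp (fps_neglog j a).

(** [S = \prod_(j >= 1) F j], in the [u]-adic topology: every coefficient of the
    partial products is eventually constant, equal to that of [S]. *)
Definition fps_is_infprod {R : comUnitRingType} (F : nat -> fps R) (S : fps R) :
    Prop :=
  forall n : nat, exists J0 : nat, forall J : nat, (J0 <= J)%N ->
    (\big[fps_mul/fps_one]_(1 <= j < J.+1) F j) n = S n.

(** Number of elements of a finite set (and 0 if [A] is infinite, which does not
    occur for the two sets counted below). *)
Definition set_count {T : choiceType} (A : set T) : nat := #|` fset_set A |%fset.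

Definition is_Zaction (r n : nat) (a : 'rV[int]_r -> 'I_n -> 'I_n) : Prop :=
  (forall x, a 0 x = x) /\ (forall u v x, a (u + v) x = a u (a v x)).

Definition Zorbit (r n : nat) (a : 'rV[int]_r -> 'I_n -> 'I_n) (x : 'I_n) :
    {set 'I_n} :=
  [set y : 'I_n | `[< exists u, a u x = y >]]%SET.

Definition num_orbits (r n : nat) (a : 'rV[int]_r -> 'I_n -> 'I_n) : nat :=
  #|[set Zorbit a x | x : 'I_n]%SET|.

(** [T_r(n, k)] *)
Definition num_actions (r n k : nat) : nat :=
  set_count [set a : 'rV[int]_r -> 'I_n -> 'I_n |
               is_Zaction a /\ num_orbits a = k]%classic.

(** [T_r(n)] *)
Definition num_commuting (r n : nat) : nat :=
  #|[pred g : r.-tuple 'S_n |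
       [forall i, forall j,
          (tnth g i * tnth g j == tnth g j * tnth g i)%g]]|.

Lemma num_actions_gt (r n k : nat) : (n < k)%N -> num_actions r n k = 0%N.
Proof.
move=> ltnk; rewrite /num_actions /set_count.
rewrite (_ : mkset _ = set0) ?fset_set0 //.
apply/seteqP; split=> // a [_ eqk]; move: ltnk; rewrite -eqk ltnNge.
by rewrite (leq_trans (leq_imset_card _ _)) ?card_ord.
Qed.

Definition coset_of_sub (V : zmodType) (H : set V) (x : V) : set V :=
  [set x + h | h in H]%classic.

Definition has_index (V : zmodType) (H : set V) (n : nat) : Prop :=
  (range (coset_of_sub H) #= `I_n)%classic%card.

(** [lambda_r(n)], for [n >= 1]. *)
Definition num_subgroups (r n : nat) : nat :=
  if r is 0%N then (n == 1%N) : nat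
  else set_count [set H : set 'rV[int]_r |
                    zmod_closed [pred x in H] /\ has_index H n]%classic.

(* Main.v *)
(** Let [W n] be the sum of [y ^ orbits] over the actions of [Z^r] on [n] points.
    Splitting off the orbit of a point, and counting the transitive actions on
    [m] points by the stabilizer ([(m - 1)!] for each subgroup of index [m]),
    gives [n * (W n / n!) = sum_m y lambda_r(m) (W (n - m) / (n - m)!)].
    A subgroup of [Z^(r-1) * Z] of index [n] is given by its trace [K] on
    [Z^(r-1)], of some index [j] dividing [n], and a coset of [K], whence
    [lambda_r(n) = sum_(j | n) j lambda_(r-1)(j)].  Applying [u d/du] to the
    logarithm of the product shows that its coefficients satisfy the same
    recursion. *)

Require Import Defs.
From mathcomp Require Import all_boot all_order all_algebra all_fingroup.
From mathcomp Require Import finmap all_classical.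
From mathcomp Require Import ring.

Set Implicit Arguments.
Unset Strict Implicit.
Unset Printing Implicit Defensive.

Import GRing.Theory.
Local Open Scope ring_scope.

(** * Formal power series *)

(** The factor [(m - 1)!] counts the bijections from the cosets of a subgroup of index [m] to the
    orbit that send the subgroup itself to the chosen point. Such an orbit can be chosen in
    ['C(n - 1, m - 1)] ways, and [(m - 1)! * 'C(n - 1, m - 1) * (n - m)! = (n - 1)!]; this is why
    the recursion becomes clean for [W n / n!]. Both identities come from one statement over any
    ring in which the positive integers are invertible, taken at [y = 'X] and at [y = 1]. The
    counted objects are functions on, or subsets of, an infinite group, so finiteness has to be
    carried along with the counts. *)

(** Truncation to polynomials lets the product of series inherit commutativity and associativity
    from [{poly R}]. *)
Lemma fps_mul_poly (R : comUnitRingType) (f g : fps R) (N n : nat) :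
  (n < N)%N ->
  fps_mul f g n = ((\poly_(i < N) f i) * (\poly_(i < N) g i))`_n.
Proof.
move=> ltnN; rewrite coefM; apply: eq_bigr => i _.
rewrite !coef_poly (leq_ltn_trans _ ltnN) ?(leq_ltn_trans _ ltnN) ?leq_subr //.
by rewrite -ltnS.
Qed.

Lemma fps_mulC (R : comUnitRingType) (f g : fps R) : fps_mul f g = fps_mul g f.
Proof.
by apply/funext => n; rewrite !(fps_mul_poly _ _ (ltnSn n)) mulrC.
Qed.

Lemma fps_mulA (R : comUnitRingType) (f g h : fps R) :
  fps_mul f (fps_mul g h) = fps_mul (fps_mul f g) h.
Proof.
have truncM (f1 g1 : fps R) n i : (i < n.+1)%N ->
    (\poly_(j < n.+1) fps_mul f1 g1 j)`_i =
    ((\poly_(j < n.+1) f1 j) * (\poly_(j < n.+1) g1 j))`_i.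
  by move=> lti; rewrite coef_poly lti (fps_mul_poly _ _ lti).
apply/funext => n; rewrite !(fps_mul_poly _ _ (ltnSn n)).
pose P (e : fps R) := \poly_(j < n.+1) e j.
transitivity ((P f * (P g * P h))`_n).
  by rewrite !coefM; apply: eq_bigr => i _; rewrite truncM // ltnS leq_subr.
by rewrite mulrA !coefM; apply: eq_bigr => i _; rewrite truncM.
Qed.

Lemma fps_mulCA (R : comUnitRingType) (f g h : fps R) :
  fps_mul f (fps_mul g h) = fps_mul g (fps_mul f h).
Proof. by rewrite !fps_mulA (fps_mulC f). Qed.

Lemma fps_mul1 (R : comUnitRingType) (f : fps R) : fps_mul fps_one f = f.
Proof.
apply/funext => n; rewrite /fps_mul big_ord_recl /fps_one mul1r subn0.
by rewrite big1 ?addr0 // => i _; rewrite mul0r.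
Qed.

(* The Euler operator [u d/du], a derivation. *)
Definition fps_euler (R : comUnitRingType) (f : fps R) : fps R :=
  fun n => f n *+ n.

Lemma fps_eulerM (R : comUnitRingType) (f g : fps R) (n : nat) :
  fps_euler (fps_mul f g) n =
  fps_mul (fps_euler f) g n + fps_mul f (fps_euler g) n.
Proof.
rewrite /fps_euler /fps_mul -sumrMnl -big_split; apply: eq_bigr => i _ /=.
by rewrite mulrnAl mulrnAr -mulrnDr subnKC // -ltnS.
Qed.

Lemma fps_euler1 (R : comUnitRingType) : fps_euler fps_one = (fun=> 0 : R).
Proof. by apply/funext => -[|n]; rewrite /fps_euler /fps_one ?mul0rn. Qed.

Lemma fps_mul0 (R : comUnitRingType) (f : fps R) :
  fps_mul f (fun=> 0) = (fun=> 0).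
Proof. by apply/funext => n; apply: big1 => i _; rewrite mulr0. Qed.

Lemma fps_euler_pow (R : comUnitRingType) (f : fps R) (k n : nat) :
  fps_euler (fps_pow f k.+1) n =
  fps_mul (fps_euler f) (fps_pow f k) n *+ k.+1.
Proof.
have powS m : fps_pow f m.+1 = fps_mul f (fps_pow f m) by [].
elim: k n => [|k IHk] n; rewrite powS fps_eulerM.
  by rewrite fps_euler1 fps_mul0 addr0.
rewrite mulrS; congr (_ + _).
rewrite powS fps_mulCA -sumrMnl; apply: eq_bigr => i _.
by rewrite IHk mulrnAr.
Qed.

Lemma fps_euler_exp (R : comUnitRingType) (f : fps R) :
  (forall n : nat, n.+1%:R \is a @GRing.unit R) -> f 0%N = 0 ->
  fps_euler (fps_exp f) = fps_mul (fps_euler f) (fps_exp f).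
Proof.
move=> unitR f0; apply/funext => n.
have factE k : (k.+1`!%:R)^-1 * k.+1%:R = (k`!%:R)^-1 :> R.
  have unitf : k`!%:R \is a @GRing.unit R by rewrite -(prednK (fact_gt0 k)).
  by rewrite factS natrM invrM // mulrVK.
(* The term of exponent 0 is killed, and [(k + 1) / (k + 1)! = 1 / k!] shifts the exponential series
   by one. *)
transitivity (\sum_(k < n) (k`!%:R)^-1 * fps_mul (fps_euler f) (fps_pow f k) n).
  rewrite /fps_euler /fps_exp big_ord_recl mulrnDl.
  rewrite [X in X + _](_ : _ = 0) ?add0r; last first.
    by case: n => [|n] //; rewrite /fps_pow /= /fps_one /= mulr0 mul0rn.
  rewrite -sumrMnl; apply: eq_bigr => k _; rewrite lift0 -mulrnAr.
  by rewrite -[X in _ * X]/(fps_euler _ n) fps_euler_pow -[_ *+ k.+1]mulr_natl mulrA factE.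
under eq_bigr do rewrite /fps_mul mulr_sumr.
rewrite exchange_big /=; apply: eq_bigr => -[[|i] lti] _ /=.
  by rewrite /fps_euler mulr0n mul0r big1 // => k _; rewrite mul0r mulr0.
(* The inner exponential stops at [k <= n - i.+1]; the terms added up to [k < n] vanish by
   [fps_pow_small]. *)
rewrite /fps_exp mulr_sumr (big_ord_widen n
  (fun k => fps_euler f i.+1 * ((k`!%:R)^-1 * fps_pow f k (n - i.+1)%N))).
  rewrite [RHS]big_mkcond /=; apply: eq_bigr => k _; rewrite mulrCA.
  by case: leqP => // ltk; rewrite fps_pow_small ?mulr0.
by rewrite subnSK // leq_subr.
Qed.

(** Logarithmic differentiation: every factor is an exponential, so the exponents play the part of
    the logarithms. *)
Lemma fps_euler_prod (R : comUnitRingType) (f : nat -> fps R) (s : seq nat) :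
  (forall n : nat, n.+1%:R \is a @GRing.unit R) ->
  (forall j, f j 0%N = 0) ->
  fps_euler (\big[fps_mul/fps_one]_(j <- s) fps_exp (f j)) =
  fps_mul (fun n => \sum_(j <- s) fps_euler (f j) n)
    (\big[fps_mul/fps_one]_(j <- s) fps_exp (f j)).
Proof.
move=> unitR f0; elim: s => [|j s IHs].
  rewrite big_nil fps_euler1 fps_mulC fps_mul1.
  by apply/funext => n; rewrite big_nil.
rewrite big_cons; apply/funext => n; rewrite fps_eulerM IHs fps_euler_exp //.
rewrite -fps_mulA [X in _ + X n]fps_mulCA.
rewrite {1 3}/fps_mul -big_split; apply: eq_bigr => i _ /=.
by rewrite big_cons mulrDl.
Qed.

Lemma fps_neglog0 (R : comUnitRingType) (j : nat) (a : R) :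
  fps_neglog j a 0%N = 0.
Proof. by rewrite /fps_neglog big_geq. Qed.

Lemma fps_geompow_prod0 (R : comUnitRingType) (a : nat -> R) (s : seq nat) :
  (\big[fps_mul/fps_one]_(j <- s) fps_geompow j (a j)) 0%N = 1.
Proof.
elim/big_rec: _ => // j f _ f0.
by rewrite /fps_mul big_ord1 f0 mulr1 /fps_geompow /fps_exp big_ord1 fact0 invr1 mul1r.
Qed.

(** The Euler operator turns [fps_neglog j a] into the series with coefficient [a *+ j] at each
    positive multiple of [j]. In degree [i <= n] only the divisors of [i] contribute, and they all
    occur in the product because [n <= J]. *)
Lemma fps_geompow_prodS (R : comUnitRingType) (a : nat -> R) (J n : nat) :
  (forall n : nat, n.+1%:R \is a @GRing.unit R) -> (0 < n <= J)%N ->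
  let P := \big[fps_mul/fps_one]_(1 <= j < J.+1) fps_geompow j (a j) in
  P n *+ n = \sum_(1 <= i < n.+1)
    (\sum_(1 <= j < i.+1 | (j %| i)%N) a j *+ j) * P (n - i)%N.
Proof.
move=> unitR /andP[n_gt0 leJ] P.
rewrite -[LHS]/(fps_euler _ n) /P /fps_geompow fps_euler_prod //; last first.
  by move=> j; exact: fps_neglog0.
transitivity (\sum_(0 <= i < n.+1)
  (\sum_(1 <= j < J.+1) fps_euler (fps_neglog j (a j)) i) * P (n - i)%N).
  by rewrite big_mkord.
rewrite (@big_ltn _ _ _ 0 n.+1) // [X in X * _ + _]big1 ?mul0r ?add0r //.
rewrite big_nat [RHS]big_nat; apply: eq_bigr => i /andP[i_gt0 lei].
congr (_ * _).
rewrite (big_cat_nat (n := i.+1)) //=; last by rewrite (leq_trans lei).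
rewrite [X in _ + X]big_nat [X in _ + X]big1 ?addr0; last first.
  move=> j /andP[ltj _]; rewrite /fps_euler /fps_neglog big_nat_cond big1 ?mul0rn//.
  move=> m /andP[/andP[m_gt0 _] /eqP jm].
  by move: ltj; rewrite -jm -{2}(muln1 j) ltnNge leq_mul.
rewrite [RHS]big_mkcond big_nat [RHS]big_nat; apply: eq_bigr => j /andP[j_gt0 _].
rewrite /fps_euler /fps_neglog; case: ifPn => [/dvdnP[m im]|ndvd]; last first.
  rewrite big1 ?mul0rn // => m /eqP jm.
  by rewrite -jm dvdn_mulr in ndvd.
have m_gt0 : (0 < m)%N by move: i_gt0; rewrite im; case: (m).
(* Only the cofactor [m = i / j] survives, and [i * (a j / m) = j * a j]. *)
rewrite big_mkcond (bigD1_seq m) /= ?iota_uniq ?mem_index_iota //; last first.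
  by rewrite m_gt0 ltnS im leq_pmulr.
rewrite {1}im mulnC eqxx big1 ?addr0 => [|k kNm].
  rewrite {}im -[LHS]mulr_natr natrM mulrA mulrVK ?mulr_natr //.
  by rewrite -(prednK m_gt0).
by rewrite im mulnC eqn_pmul2r // (negPf kNm).
Qed.

(** * Sums and cardinals over fibers *)

Lemma fsbig_fibers (R : Type) (idx : R) (op : Monoid.com_law idx)
    (I J : choiceType) (A : set I) (B : set J) (f : I -> J) (F : I -> R) :
  finite_set A -> finite_set B -> (forall a, A a -> B (f a)) ->
  \big[op/idx]_(a \in A) F a =
  \big[op/idx]_(b \in B) \big[op/idx]_(a \in (A `&` f @^-1` [set b])%classic) F a.
Proof.
move=> finA finB fAB; rewrite [RHS]fsbig_finite //.
rewrite [RHS](eq_bigr (fun b => \big[op/idx]_(a <- fset_set A)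
    if a \in (f @^-1` [set b])%classic then F a else idx)); last first.
  by move=> b _; rewrite fsbig_mkcondr fsbig_finite.
rewrite fsbig_finite // exchange_big /= !big_seq; apply: eq_bigr => a.
rewrite in_fset_set // => /set_mem Aa.
rewrite (bigD1_seq (f a)) //=; last first.
  by rewrite in_fset_set //; apply/mem_set/fAB.
rewrite ifT ?inE // big1 ?Monoid.mulm1 // => b bNfa.
by rewrite ifF //; apply/negP; rewrite inE => fab; rewrite fab eqxx in bNfa.
Qed.

Lemma fsbig_setX (R : Type) (idx : R) (op : Monoid.com_law idx)
    (I J : choiceType) (A : set I) (B : set J) (F : I * J -> R) :
  finite_set A -> finite_set B ->
  \big[op/idx]_(p \in (A `*` B)%classic) F p =
  \big[op/idx]_(a \in A) \big[op/idx]_(b \in B) F (a, b).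
Proof.
move=> finA finB.
rewrite (fsbig_fibers _ _ (finite_setX finA finB) finA (f := fst)); last first.
  by move=> p [].
apply: eq_fsbigr => a /set_mem Aa.
rewrite -(@fsbig_image _ _ _ _ _ B (pair a)); last by move=> b b' _ _ [].
apply: eq_fsbigl; apply/seteqP; split=> [[a' b] [[_ Bb] /= ->]|_ [b Bb <-]] //.
by exists b.
Qed.

Lemma set_count_fsbig (T : choiceType) (A : set T) :
  finite_set A -> set_count A = \big[addn/0%N]_(a \in A) 1%N.
Proof. by move=> finA; rewrite fsbig_finite // sum1_size. Qed.

Lemma set_count_image (T U : choiceType) (A : set T) (f : T -> U) :
  finite_set A -> {in A &, injective f} ->
  set_count (f @` A)%classic = set_count A.
Proof.
move=> finA injf; rewrite !set_count_fsbig //; last exact: finite_image.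
by rewrite fsbig_image.
Qed.

Lemma set_count_fin (T : finType) (A : {pred T}) : set_count [set` A] = #|A|.
Proof.
rewrite set_count_fsbig ?finite_finset // -sum1_card -big_enum.
rewrite [RHS]fsbig_seq ?enum_uniq //; congr (\big[_/_]_(x \in _) _).
by apply/seteqP; split=> x /=; rewrite mem_enum.
Qed.

Lemma finite_fibers (T U : choiceType) (A : set T) (B : set U) (f : T -> U) :
  finite_set B -> (forall a, A a -> B (f a)) ->
  (forall b, B b -> finite_set (A `&` f @^-1` [set b])%classic) -> finite_set A.
Proof.
move=> finB fAB finf; apply: sub_finite_set (bigcup_finite finB finf).
by move=> a Aa; exists (f a); first exact: fAB.
Qed.

(** Used with [c] the index of the trace of a subgroup, and with [c = (m - 1)!] for the actions
    sharing a stabilizer. *)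
Lemma set_count_fibers (T U : choiceType) (A : set T) (B : set U)
    (f : T -> U) (c : nat) :
  finite_set A -> finite_set B -> (forall a, A a -> B (f a)) ->
  (forall b, B b -> set_count (A `&` f @^-1` [set b])%classic = c) ->
  set_count A = (c * set_count B)%N.
Proof.
move=> finA finB fAB cB; rewrite set_count_fsbig // (fsbig_fibers _ _ finA finB fAB).
rewrite (eq_fsbigr (fun=> c)) => [|b /set_mem Bb]; last first.
  by rewrite -set_count_fsbig ?cB //; apply: finite_setIl.
by rewrite fsbig_finite // big_const_seq count_predT iter_addn_0.
Qed.

(** * Subgroups of finite index *)

Lemma zmod_closedE (V : zmodType) (H : set V) :
  zmod_closed [pred x in H] <->
  H 0 /\ (forall x y, H x -> H y -> H (x - y)).
Proof.
split=> [[H0 HB]|[H0 HB]]; split.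
- by move: H0; rewrite !inE.
- by move=> x y Hx Hy; have := HB x y; rewrite !inE; apply.
- by rewrite !inE.
- by move=> x y; rewrite !inE; apply: HB.
Qed.

(* [f] induces an injection of [V / H] into [T]. *)
Definition coset_map (V : zmodType) (T : Type) (H : set V) (f : V -> T) : Prop :=
  forall x y, f x = f y <-> H (x - y).

Lemma coset_of_subP (V : zmodType) (H : set V) :
  zmod_closed [pred x in H] -> coset_map H (coset_of_sub H).
Proof.
move=> /zmod_closedE[H0 HB] x y; split=> [xy|Hxy].
  have [h Hh <-] : coset_of_sub H y x by rewrite -xy; exists 0; rewrite ?addr0.
  by rewrite addrC addKr.
have Hyx : H (y - x) by rewrite -opprB -sub0r; exact: HB.
have HD a b : H a -> H b -> H (a + b).
  by move=> Ha Hb; rewrite -[b]opprK; apply: (HB) => //; rewrite -sub0r; exact: HB.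
apply/seteqP; split=> _ [h Hh <-].
  by exists (x - y + h); [exact: HD|rewrite addrA subrKC].
by exists (y - x + h); [exact: HD|rewrite addrA subrKC].
Qed.

Lemma has_index_uniq (V : zmodType) (H : set V) (m n : nat) :
  has_index H m -> has_index H n -> m = n.
Proof.
rewrite /has_index => mH nH; apply/card_eq_II.
by apply: card_eq_trans nH; rewrite card_eq_sym.
Qed.

(** Every index below is computed this way, as the size of the image of a map whose fibers are the
    cosets: quotient and remainder, orbit maps, restrictions. [has_index_ord] is the converse, a
    numbering of the cosets. *)
Lemma has_index_card (V : zmodType) (T : finType) (H : set V) (f : V -> T)
    (O : {set T}) :
  zmod_closed [pred x in H] -> coset_map H f ->
  (forall x, x \in O <-> exists v, f v = x) -> has_index H #|O|.
Proof.
move=> Hz fH imf; have cosH := coset_of_subP Hz; rewrite /has_index.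
have /choice[s sE] (i : 'I_#|O|) : exists v, f v = enum_val i.
  by apply/imf; apply: enum_valP.
rewrite (_ : range _ = (coset_of_sub H \o s) @` [set: 'I_#|O|])%classic.
  apply: (card_eq_trans (inj_card_eq _)); last by rewrite card_eq_sym card_II.
  by move=> i j _ _ /= /cosH/fH; rewrite !sE => /enum_val_inj.
apply/seteqP; split=> [_ [v _ <-]|_ [i _ <-]]; last by exists (s i).
have Ofv : f v \in O by apply/imf; exists v.
by exists (enum_rank_in Ofv (f v)) => //=; apply/cosH/fH; rewrite sE enum_rankK_in.
Qed.

Lemma has_index_ord (V : zmodType) (H : set V) (n : nat) :
  zmod_closed [pred x in H] -> has_index H n ->
  exists f : V -> 'I_n, coset_map H f /\ forall i, exists v, f v = i.
Proof.
move=> Hz /pcard_eqP[f]; have cosH := coset_of_subP Hz.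
have [fS finj fsurj] : set_bij (range (coset_of_sub H)) `I_n f by exact: bij.
have fn v : (f (coset_of_sub H v) < n)%N by apply: fS; exists v.
exists (fun v => Ordinal (fn v)); split=> [x y|i].
  rewrite -cosH; split=> [[]|xy]; last by apply: val_inj; rewrite /= xy.
  by apply: finj; rewrite inE; [exists x|exists y].
have [_ [v _ <-] vi] := fsurj i (ltn_ord i).
by exists v; apply: val_inj.
Qed.

Lemma has_index_gt0 (V : zmodType) (H : set V) (n : nat) :
  zmod_closed [pred x in H] -> has_index H n -> (0 < n)%N.
Proof.
move=> Hz /(has_index_ord Hz)[f _]; exact: leq_ltn_trans (leq0n _) (ltn_ord (f 0)).
Qed.

Definition subgroups (V : zmodType) (n : nat) : set (set V) :=
  [set H : set V | zmod_closed [pred x in H] /\ has_index H n]%classic.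

Lemma subrBACA (V : zmodType) (x y z t : V) :
  x - y - (z - t) = x - z - (y - t).
Proof. by rewrite !opprB addrACA [RHS]addrACA [- y - z]addrC. Qed.

(* Every subgroup of [V * Z] of finite index is [subgroup_ext K m c] for
   [K = subgroup_res H] and [m * Z] its projection to [Z], where [(c, m)] is a
   lift of [m] to [H]; only the class of [c] modulo [K] matters. *)
Definition subgroup_ext (V : zmodType) (K : set V) (m : nat) (c : V) :
    set (V * int) :=
  [set p | exists k : int, p.2 = k * m%:Z /\ K (p.1 - c *~ k)]%classic.

Definition subgroup_res (V : zmodType) (H : set (V * int)) : set V :=
  [set w | H (w, 0)]%classic.

Lemma subgroup_ext_closed (V : zmodType) (K : set V) (m : nat) (c : V) :
  zmod_closed [pred x in K] -> zmod_closed [pred x in subgroup_ext K m c].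
Proof.
move=> /zmod_closedE[K0 KB]; apply/zmod_closedE; split.
  by exists 0; rewrite mul0r mulr0z subr0.
move=> x y [k [xk Kx]] [l [yl Ky]]; exists (k - l); split.
  by rewrite /= xk yl mulrBl.
by rewrite /= mulrzBr subrBACA; exact: KB.
Qed.

Lemma subgroup_res_closed (V : zmodType) (H : set (V * int)) :
  zmod_closed [pred x in H] -> zmod_closed [pred x in subgroup_res H].
Proof.
move=> /zmod_closedE[H0 HB]; apply/zmod_closedE; split=> // x y Hx Hy.
by have := HB _ _ Hx Hy; rewrite -[_ - _]/(x - y, 0 - 0) subr0.
Qed.

Lemma subgroup_ext_res (V : zmodType) (K : set V) (m : nat) (c : V) :
  (0 < m)%N -> subgroup_res (subgroup_ext K m c) = K.
Proof.
move=> m_gt0; apply/seteqP; split=> w /=.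
  move=> [k [/= /esym/eqP]]; rewrite mulf_eq0 => /orP[/eqP->|].
    by rewrite mulr0z subr0.
  by rewrite eqz_nat; case: m m_gt0.
by move=> Kw; exists 0; rewrite mul0r mulr0z subr0.
Qed.

(** Subtracting a multiple of [(c, m)] brings the second coordinate of a point into [[0, m)]. The
    coset is then given by this remainder and by the class modulo [K] of the adjusted first
    coordinate. *)
Lemma has_index_subgroup_ext (V : zmodType) (K : set V) (j m : nat) (c : V) :
  zmod_closed [pred x in K] -> has_index K j -> (0 < m)%N ->
  has_index (subgroup_ext K m c) (j * m).
Proof.
move=> Kz Kj; case: m => // m _; have [f [fK fsurj]] := has_index_ord Kz Kj.
pose q (z : int) := (z %/ m.+1)%Z; pose s (z : int) := (z %% m.+1)%Z.
have sE z : `|s z|%N%:Z = s z by rewrite gez0_abs ?modz_ge0.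
have ltsm z : (`|s z| < m.+1)%N by rewrite -ltz_nat sE ltz_pmod.
pose g p := (f (p.1 - c *~ q p.2), Ordinal (ltsm p.2)).
have gH : coset_map (subgroup_ext K m.+1 c) g.
  move=> x y; split=> [[/fK Kxy sxy]|[k /= [xyk Kxy]]].
    exists (q x.2 - q y.2); split=> /=.
      rewrite {1}(divz_eq x.2 m.+1) {1}(divz_eq y.2 m.+1) -/(s _) -/(s y.2).
      by rewrite -(sE x.2) sxy sE opprD addrACA subrr addr0 mulrBl.
    by rewrite mulrzBr subrBACA.
  have xE : x.2 = k * m.+1%:Z + y.2 by rewrite -xyk subrK.
  congr pair; last first.
    by apply: val_inj; rewrite /= /s xE modzMDl.
  by apply/fK; rewrite subrBACA -mulrzBr /q xE divzMDl // addrK.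
have -> : (j * m.+1)%N = #|[set: 'I_j * 'I_m.+1]|.
  by rewrite cardsT card_prod !card_ord.
apply: has_index_card gH _; first exact: subgroup_ext_closed.
move=> [i l]; split=> // _; have [v vi] := fsurj i.
exists (v, l%:Z); congr pair.
  by rewrite /= /q divz_small ?mulr0z ?subr0 // ltz_nat ltn_ord.
by apply: val_inj; rewrite /= /s modz_small // ltz_nat ltn_ord.
Qed.

Lemma zmod_closed_mulrz (V : zmodType) (H : set V) (x : V) (k : int) :
  zmod_closed [pred x in H] -> H x -> H (x *~ k).
Proof.
move=> /zmod_closedE[H0 HB] Hx.
have HN y : H y -> H (- y) by move=> Hy; rewrite -sub0r; exact: HB.
have Hn (n : nat) : H (x *+ n).
  elim: n => [|n IHn]; first by rewrite mulr0n.
  by rewrite mulrSr -[x in _ + x]opprK; apply: HB => //; exact: HN.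
by case: k => n; [exact: Hn | exact/HN/Hn].
Qed.

(** Take [m] least positive in the projection of [H] to [int]. Dividing by [m] and subtracting a
    multiple of [(c, m)] leaves in the projection a remainder below [m], hence 0. *)
Lemma subgroup_extP (V : zmodType) (H : set (V * int)) (n : nat) :
  subgroups n H ->
  exists (j m : nat) (c : V),
    [/\ (0 < m)%N, n = (j * m)%N, subgroups j (subgroup_res H) &
        H = subgroup_ext (subgroup_res H) m c].
Proof.
move=> [Hz Hn]; have [g [gH _]] := has_index_ord Hz Hn.
have Kz := subgroup_res_closed Hz.
have /zmod_closedE[H0 HB] := Hz.
have mulz_pair (a : V) (b k : int) : (a, b) *~ k = (a *~ k, b *~ k).
  by rewrite [LHS]surjective_pairing (raddfMz fst) (raddfMz snd).
(* [m] exists because the points [(0, k)] cannot all lie in distinct cosets. *)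
have exm : exists m : nat, (0 < m)%N && `[< exists c, H (c, m%:Z) >].
  have /injectivePn[a [b aNb gab]] : ~~ injectiveb (fun k : 'I_n.+1 => g (0, k%:Z)).
    by apply/negP => /injectiveP/leq_card; rewrite !card_ord ltnn.
  wlog ltab : a b aNb gab / (a < b)%N.
    move: (aNb); rewrite neq_ltn => /orP[ltab|ltba] IH; first exact: (IH a b).
    by apply: (IH b a); rewrite // eq_sym.
  exists (b - a)%N; rewrite subn_gt0 ltab; apply/asboolP; exists 0.
  move/gH: (esym gab); rewrite -[_ - _]/(0 - 0, b%:Z - a%:Z) subr0.
  by rewrite subzn // ltnW.
have [m /andP[m_gt0 /asboolP[c Hc]] minm] := ex_minnP exm.
have HE : H = subgroup_ext (subgroup_res H) m c.
  apply/seteqP; split=> -[w z].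
    move=> Hwz; pose q := (z %/ m)%Z; pose s := (z %% m)%Z.
    have zs : z - m%:Z *~ q = s.
      by rewrite mulrzz {1}(divz_eq z m) [_ * q]mulrC addrC addKr.
    have Hs : H (w - c *~ q, s).
      have := HB _ _ Hwz (zmod_closed_mulrz q Hz Hc).
      by rewrite mulz_pair -[_ - _]/(w - c *~ q, z - m%:Z *~ q) zs.
    have s0 : s = 0.
      have m_neq0 : m%:Z != 0 by rewrite eqz_nat -lt0n.
      have sE : `|s|%N%:Z = s by rewrite gez0_abs ?modz_ge0.
      apply/eqP; rewrite -absz_eq0; apply/negPn; rewrite -lt0n; apply/negP => s_gt0.
      have : (m <= `|s|)%N.
        apply: minm; rewrite s_gt0; apply/asboolP.
        by exists (w - c *~ q); rewrite sE.
      by rewrite leqNgt -ltz_nat sE ltz_pmod.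
    exists q; rewrite {1}(divz_eq z m) -/(s) -/q s0 addr0; split=> //.
    by move: Hs; rewrite s0.
  move=> [k [/= -> Kw]]; have := HB _ _ Kw (zmod_closed_mulrz (- k) Hz Hc).
  rewrite mulz_pair -[X in H X]/(w - c *~ k - c *~ (- k), 0 - m%:Z *~ (- k)).
  by rewrite !mulrNz !opprK subrK add0r mulrzz [m%:Z * k]mulrC.
have gK : coset_map (subgroup_res H) (fun w => g (w, 0)).
  by move=> x y; rewrite gH -[_ - _]/(x - y, 0 - 0) subr0.
have imK x : x \in [set x | `[< exists w, g (w, 0) = x >]]%SET <->
    exists w, g (w, 0) = x.
  by rewrite inE; split=> /asboolP.
(* The trace has finite index: its cosets correspond to the values of [g] on the points [(w, 0)]. *)
have Kj := has_index_card Kz gK imK.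
exists #|[set x | `[< exists w, g (w, 0) = x >]]%SET|, m, c; split=> //.
by apply: has_index_uniq Hn _; rewrite HE; exact: has_index_subgroup_ext.
Qed.

(** The trace forces [m = n / j], and [c] matters only modulo [K], so the subgroups correspond to
    the [j] cosets of [K], with representatives [s i]. *)
Lemma set_count_subgroup_res (V : zmodType) (K : set V) (j n : nat) :
  (0 < n)%N -> (j %| n)%N -> subgroups j K ->
  let A := (@subgroups (V * int)%type n `&` @subgroup_res V @^-1` [set K])%classic in
  finite_set A /\ set_count A = j.
Proof.
move=> n_gt0 /dvdnP[m nE] [Kz Kj] A; have [f [fK fsurj]] := has_index_ord Kz Kj.
have m_gt0 : (0 < m)%N by move: n_gt0; rewrite nE; case: (m).
have j_gt0 := has_index_gt0 Kz Kj.
have /choice[s sE] := fsurj.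
have -> : A = [set subgroup_ext K m (s i) | i in [set: 'I_j]]%classic.
  apply/seteqP; split=> [H [HS /= HK]|_ [i _ <-]].
    have [j' [m' [c [m'_gt0 nE' [_ Kj']] HE]]] := subgroup_extP HS.
    rewrite HK in Kj' HE; have ejj' := has_index_uniq Kj' Kj; subst j'.
    have emm' : m' = m.
      by apply/eqP; rewrite -(eqn_pmul2l j_gt0) -nE' nE mulnC.
    exists (f c) => //; rewrite HE emm'.
    have Kcs : K (c - s (f c)) by apply/fK; rewrite sE.
    have KB := (zmod_closedE K).1 Kz.
    have KD a b : K (a - b) -> K a <-> K b.
      move=> Kab; split=> [Ka|Kb].
        by rewrite -[b](subKr a); exact: KB.2.
      have Kba : K (b - a) by rewrite -opprB -sub0r; apply: KB.2 => //; exact: KB.1.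
      by rewrite -[a](subKr b); exact: KB.2.
    apply/seteqP; split=> p [k [pk Kp]]; exists k; split=> //.
      move: Kp; apply: (KD _ _ _).1.
      rewrite subrBACA subrr sub0r opprB -mulrzBl.
      exact: zmod_closed_mulrz.
    move: Kp; apply: (KD _ _ _).2.
    rewrite subrBACA subrr sub0r opprB -mulrzBl.
    exact: zmod_closed_mulrz.
  split; last exact: subgroup_ext_res.
  split; first exact: subgroup_ext_closed.
  by rewrite nE mulnC; exact: has_index_subgroup_ext.
split; first exact/finite_image/finite_finset.
rewrite (set_count_image finite_finset).
  have -> : [set: 'I_j]%classic = [set` 'I_j]%classic by apply/seteqP.
  by rewrite set_count_fin card_ord.
move=> a b _ _ eqab; rewrite -[a]sE -[b]sE; apply/fK.
(* In the extension built from [s b], the second coordinate [m] forces the multiplier 1, so [s a]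
   and [s b] are congruent modulo [K]. *)
have : subgroup_ext K m (s a) (s a, m%:Z).
  by exists 1; rewrite mul1r mulr1z subrr; split=> //; case/zmod_closedE: Kz.
rewrite eqab => -[k [/= /esym/eqP]].
rewrite -{2}[m%:Z]mul1r (inj_eq (mulIf _)); last by rewrite eqz_nat -lt0n.
by move=> /eqP->; rewrite mulr1z.
Qed.

Lemma subgroups0 (V : zmodType) : @subgroups V 0 = set0.
Proof. by apply/seteqP; split=> // H [Hz /(has_index_gt0 Hz)]. Qed.

Lemma finite_subgroups_prod (V : zmodType) (n : nat) :
  (forall j, finite_set (@subgroups V j)) ->
  finite_set (@subgroups (V * int)%type n).
Proof.
move=> finV; case: n => [|n]; first by rewrite subgroups0.
apply: (@finite_fibers _ _ _
  (\bigcup_(j in [set j | (j %| n.+1)%N]) @subgroups V j)%classic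
  (@subgroup_res V)).
- apply: bigcup_finite => // .
  apply: (@sub_finite_set _ _ `I_n.+2); last exact: finite_II.
  by move=> j /= /dvdn_leq; rewrite ltnS; apply.
- by move=> H /subgroup_extP[j [m [c [_ nE Kj _]]]]; exists j => //=;
    rewrite nE dvdn_mulr ?dvdnn.
- by move=> K [j /= dvdj Kj]; have [] := set_count_subgroup_res (ltn0Sn n) dvdj Kj.
Qed.

Lemma set_count_subgroups_prod (V : zmodType) (n : nat) : (0 < n)%N ->
  (forall j, finite_set (@subgroups V j)) ->
  set_count (@subgroups (V * int)%type n) =
  (\sum_(1 <= j < n.+1 | (j %| n)%N) j * set_count (@subgroups V j))%N.
Proof.
move=> n_gt0 finV; have finA := finite_subgroups_prod n finV.
(* Subgroups are sorted by the index of their trace, then by the trace itself. The default 0 never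
   arises for a subgroup of index [n], whose trace has finite index. *)
pose idx (H : set (V * int)) := xget 0%N [set j | has_index (subgroup_res H) j]%classic.
have idxE H j : has_index (subgroup_res H) j -> idx H = j.
  move=> Kj; apply: has_index_uniq (Kj).
  by apply: (@xgetPex _ 0%N [set j | has_index (subgroup_res H) j]%classic); exists j.
pose s := [seq j <- index_iota 1 n.+1 | (j %| n)%N].
have memA H : subgroups n H -> idx H \in s.
  move=> HS; have [j [m [c [m_gt0 nE [Kz Kj] _]]]] := subgroup_extP HS.
  have j_gt0 := has_index_gt0 Kz Kj.
  rewrite (idxE _ _ Kj) mem_filter mem_index_iota j_gt0 nE dvdn_mulr ?dvdnn //=.
  by rewrite ltnS leq_pmulr.
rewrite set_count_fsbig //.
rewrite (@fsbig_fibers _ _ _ _ _ _ [set` s]%classic idx) //; last exact: finite_seq.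
rewrite -fsbig_seq ?filter_uniq ?iota_uniq // big_filter.
apply: eq_bigr => j dvdj; rewrite -set_count_fsbig; last exact: finite_setIl.
apply: (@set_count_fibers _ _ _ _ (@subgroup_res V)) => //.
- exact: finite_setIl.
- move=> H [HS /= Hj]; have [j' [m [c [_ _ Kj' _]]]] := subgroup_extP HS.
  by rewrite -Hj (idxE _ _ Kj'.2).
move=> K Kj; have [_ jE] := set_count_subgroup_res n_gt0 dvdj Kj.
rewrite -[RHS]jE; congr (set_count _); apply/seteqP; split=> H; first by move=> [[]].
move=> [HS /= HK]; split=> //; split=> //=; apply: idxE; rewrite HK.
exact: Kj.2.
Qed.

(** * Transport to row vectors and induction on the rank *)

Lemma subgroups_preimage (U V : zmodType) (e : U -> V) (e' : V -> U) (n : nat)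
    (H : set V) : zmod_morphism e -> cancel e' e ->
  subgroups n H -> subgroups n (e @^-1` H)%classic.
Proof.
move=> eB e'K [Hz Hn]; have [f [fH fsurj]] := has_index_ord Hz Hn.
have [H0 HB] := (zmod_closedE H).1 Hz.
have ez : zmod_closed [pred x in (e @^-1` H)%classic].
  apply/zmod_closedE; split=> [|x y Hx Hy]; last by rewrite /= eB; exact: HB.
  by rewrite /= -[0](subrr 0) eB subrr.
split=> //; rewrite -[n]card_ord -cardsT.
apply: (@has_index_card _ _ _ (f \o e)) => // [x y|i].
  by rewrite /= fH eB.
rewrite inE; split=> // _; have [v vi] := fsurj i.
by exists (e' v); rewrite /= e'K.
Qed.

Lemma subgroups_image (U V : zmodType) (e : U -> V) (e' : V -> U) (n : nat) :
  zmod_morphism e -> zmod_morphism e' -> cancel e e' -> cancel e' e ->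
  @subgroups U n = ((fun H => e @^-1` H) @` @subgroups V n)%classic.
Proof.
move=> eB e'B eK e'K; apply/seteqP; split=> [H HS|_ [H HS <-]]; last first.
  exact: subgroups_preimage eB e'K HS.
exists (e' @^-1` H)%classic; first exact: subgroups_preimage e'B eK HS.
by apply/seteqP; split=> x /=; rewrite eK.
Qed.

Lemma subgroups_rV (r n : nat) :
  finite_set (@subgroups ('rV[int]_r * int)%type n) ->
  finite_set (@subgroups 'rV[int]_r.+1 n) /\
  set_count (@subgroups 'rV[int]_r.+1 n) =
  set_count (@subgroups ('rV[int]_r * int)%type n).
Proof.
pose e (v : 'rV[int]_r.+1) := (\row_i v 0 (lift ord0 i), v 0 ord0).
pose e' (p : 'rV[int]_r * int) : 'rV[int]_r.+1 :=
  \row_i (if unlift ord0 i is Some j then p.1 0 j else p.2).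
have eB : zmod_morphism e.
  by move=> u v; congr pair; [apply/rowP => i|]; rewrite !mxE.
have e'B : zmod_morphism e'.
  by move=> u v; apply/rowP => i; rewrite !mxE; case: unliftP => *; rewrite ?mxE.
have eK : cancel e e'.
  move=> v; apply/rowP => i; rewrite !mxE; case: unliftP => [j ->|->] //=.
  by rewrite mxE.
have e'K : cancel e' e.
  move=> [v z]; congr pair; first apply/rowP => i; rewrite !mxE ?liftK //=.
  by rewrite unlift_none.
rewrite (subgroups_image _ eB e'B eK e'K) => finS.
split; first exact: finite_image.
rewrite set_count_image // => H K _ _ /= HK.
apply/seteqP; split=> x.
  move=> Hx; have : (e @^-1` H)%classic (e' x) by rewrite /= e'K.
  by rewrite HK /= e'K.
move=> Kx; have : (e @^-1` K)%classic (e' x) by rewrite /= e'K.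
by rewrite -HK /= e'K.
Qed.

(** Starts the induction on the rank, and shows that the convention for [r = 0] in [num_subgroups]
    agrees with the actual count for the trivial group. *)
Lemma subgroups_rV0 (n : nat) :
  @subgroups 'rV[int]_0 n = (if n == 1%N then [set setT] else set0)%classic.
Proof.
have rV0 (x y : 'rV[int]_0) : x = y by rewrite thinmx0 [y]thinmx0.
have setTz : zmod_closed [pred x in [set: 'rV[int]_0]%classic] by apply/zmod_closedE.
have setT1 : has_index [set: 'rV[int]_0]%classic 1.
  have := @has_index_card _ 'I_1 _ (fun=> ord0) [set: 'I_1] setTz.
  rewrite cardsT card_ord; apply=> //.
  by move=> i; rewrite inE; split=> // _; exists 0; rewrite [i]ord1.
have subE H : zmod_closed [pred x in H] -> H = [set: 'rV[int]_0]%classic.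
  move=> /zmod_closedE[H0 _]; apply/seteqP; split=> // x _.
  by rewrite (rV0 x 0).
case: eqP => [->|n1]; apply/seteqP; split=> H //=.
- by case=> /subE.
- by move=> ->.
by case=> /subE-> Hn; case: n1; apply: has_index_uniq Hn setT1.
Qed.

Lemma finite_subgroups_rV (r n : nat) : finite_set (@subgroups 'rV[int]_r n).
Proof.
elim: r n => [|r IHr] n.
  by rewrite subgroups_rV0; case: ifP.
by have [] := subgroups_rV (finite_subgroups_prod n IHr).
Qed.

Lemma num_subgroupsE (r n : nat) :
  num_subgroups r n = set_count (@subgroups 'rV[int]_r n).
Proof.
case: r => // ; rewrite subgroups_rV0 /=.
by case: eqP => _; rewrite /set_count ?fset_set1 ?fset_set0 ?cardfs1.
Qed.

Lemma num_subgroupsS (r n : nat) : (0 < n)%N ->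
  num_subgroups r.+1 n = (\sum_(1 <= j < n.+1 | (j %| n)%N) j * num_subgroups r j)%N.
Proof.
move=> n_gt0; have fin := finite_subgroups_rV r.
rewrite num_subgroupsE (subgroups_rV (finite_subgroups_prod n fin)).2.
rewrite set_count_subgroups_prod //.
by apply: eq_bigr => j _; rewrite num_subgroupsE.
Qed.

(** * Actions on finite sets *)

(* Actions on a subset [S] are encoded as actions on all of [T] that are trivial
   outside [S], so that no transport to a subtype is ever needed. *)
Definition actions_on (V : zmodType) (T : finType) (S : {set T}) :
    set (V -> T -> T) :=
  [set a : V -> T -> T | [/\ forall x, a 0 x = x,
    forall u v x, a (u + v) x = a u (a v x) &
    forall v x, x \notin S -> a v x = x]]%classic.

Definition action_orbit (V : zmodType) (T : finType) (a : V -> T -> T) (x : T) :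
    {set T} :=
  [set y : T | `[< exists u, a u x = y >]]%SET.

Definition orbits_on (V : zmodType) (T : finType) (S : {set T})
    (a : V -> T -> T) : {set {set T}} :=
  [set action_orbit a x | x in S]%SET.

Definition transitive_actions (V : zmodType) (T : finType) (O : {set T})
    (x0 : T) : set (V -> T -> T) :=
  [set a : V -> T -> T | actions_on O a /\ action_orbit a x0 = O]%classic.

Lemma action_orbitP (V : zmodType) (T : finType) (a : V -> T -> T) (x y : T) :
  reflect (exists u, a u x = y) (y \in action_orbit a x).
Proof. by rewrite inE; apply: asboolP. Qed.

Lemma actionNK (V : zmodType) (T : finType) (S : {set T}) (a : V -> T -> T)
    (v : V) :
  actions_on S a -> cancel (a v) (a (- v)) /\ cancel (a (- v)) (a v).
Proof.
by move=> [a0 aD _]; split=> x; rewrite -aD (addNr, subrr) a0.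
Qed.

Lemma actions_on_stable (V : zmodType) (T : finType) (S : {set T})
    (a : V -> T -> T) (v : V) (x : T) :
  actions_on S a -> (a v x \in S) = (x \in S).
Proof.
move=> aS; have [avK avNK] := actionNK v aS; case: aS => _ _ aS.
apply/idP/idP => [|xS]; first by apply: contraLR => xNS; rewrite aS.
(* A point [a v x] outside [S] would be fixed by [- v], which however brings it back to [x]. *)
by apply/negPn/negP => avN; move: (avN); rewrite -(aS (- v) _ avN) avK xS.
Qed.

Lemma action_orbit_refl (V : zmodType) (T : finType) (S : {set T})
    (a : V -> T -> T) (x : T) :
  actions_on S a -> x \in action_orbit a x.
Proof. by move=> [a0 _ _]; apply/action_orbitP; exists 0. Qed.

Lemma action_orbit_eq (V : zmodType) (T : finType) (S : {set T})
    (a : V -> T -> T) (x y : T) :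
  actions_on S a -> y \in action_orbit a x -> action_orbit a y = action_orbit a x.
Proof.
move=> aS /action_orbitP[u <-]; have [_ aD _] := aS; have [auK _] := actionNK u aS.
apply/setP => z; apply/action_orbitP/action_orbitP => -[v <-].
  by exists (v + u).
by exists (v - u); rewrite aD auK.
Qed.

Lemma action_orbit_sub (V : zmodType) (T : finType) (S : {set T})
    (a : V -> T -> T) (x : T) :
  actions_on S a -> x \in S -> action_orbit a x \subset S.
Proof.
move=> aS xS; apply/fintype.subsetP => _ /action_orbitP[u <-].
by rewrite (actions_on_stable _ _ aS).
Qed.

(* The transitive action on [O] having [f] as its orbit map [v |-> a v (f 0)];
   [xget] picks some [w] in the fiber of [f] over [x]. *)
Definition action_of_map (V : zmodType) (T : finType) (O : {set T})
    (f : V -> T) (v : V) (x : T) : T :=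
  if x \in O then f (v + xget 0 [set w | f w = x]%classic) else x.

Lemma xget_map (V : zmodType) (T : finType) (O : {set T}) (f : V -> T) (x : T) :
  (forall x, x \in O <-> exists v, f v = x) -> x \in O ->
  f (xget 0 [set w | f w = x]%classic) = x.
Proof. by move=> fO /fO; apply: (@xgetPex _ 0 [set w | f w = x]%classic). Qed.

(** The choice made by [xget] is harmless: two points in a fiber of [f] differ by an element of [H],
    and adding [u] to both keeps the difference, so [f (u + w)] depends only on [u] and [f w]. *)
Lemma action_of_mapP (V : zmodType) (T : finType) (H : set V) (O : {set T})
    (f : V -> T) :
  coset_map H f -> (forall x, x \in O <-> exists v, f v = x) ->
  [/\ transitive_actions O (f 0) (action_of_map O f),
      forall v, action_of_map O f v (f 0) = f v &
      [set v | action_of_map O f v (f 0) = f 0]%classic = H].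
Proof.
move=> fH fO; have fD u v w : f v = f w -> f (u + v) = f (u + w).
  by move=> /fH Hvw; apply/fH; rewrite opprD addrACA subrr add0r.
have Of v : f v \in O by apply/fO; exists v.
have sE x : x \in O -> f (xget 0 [set w | f w = x]%classic) = x by exact: xget_map.
have aE v : action_of_map O f v (f 0) = f v.
  by rewrite /action_of_map Of -[in RHS](addr0 v); apply/fD/sE.
split=> //; last first.
  by apply/seteqP; split=> v /=; rewrite aE fH subr0.
split; last first.
  apply/setP => x; apply/action_orbitP/idP => [[u <-]|/fO[v <-]].
    by rewrite aE.
  by exists v.
split=> [x|u v x|v x /negPf xNO]; rewrite /action_of_map ?xNO //.
  by case: ifP => // xO; rewrite add0r sE.
case: ifP => xO; last by rewrite xO.
by rewrite Of -addrA; apply/fD/esym/sE.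
Qed.

(** Writing a point of [O] as [a w x0] gives [a v (a w x0) = a (v + w) x0]: counting transitive
    actions amounts to counting orbit maps. *)
Lemma transitive_action_of_map (V : zmodType) (T : finType) (O : {set T})
    (x0 : T) (a : V -> T -> T) :
  transitive_actions O x0 a -> a = action_of_map O (a^~ x0).
Proof.
move=> [[a0 aD aN] aO]; apply/funext => v; apply/funext => x.
rewrite /action_of_map; case: ifPn => [xO|/aN->//].
rewrite aD; congr (a v _); apply/esym/(@xget_map _ _ O (a^~ x0)) => // y.
by rewrite -{1}aO; split=> /action_orbitP.
Qed.

Lemma transitive_stabilizer (V : zmodType) (T : finType) (O : {set T})
    (x0 : T) (a : V -> T -> T) :
  transitive_actions O x0 a ->
  let H := [set v | a v x0 = x0]%classic in
  coset_map H (a^~ x0) /\ subgroups #|O| H.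
Proof.
move=> [aO orbO] H; have [a0 aD _] := aO.
have aH : coset_map H (a^~ x0).
  move=> u v; have [avK avNK] := actionNK v aO; rewrite /H /= addrC aD.
  by split=> [->|uv]; [exact: avK|rewrite -[LHS]avNK uv].
have Hz : zmod_closed [pred x in H].
  apply/zmod_closedE; split=> [|u v Hu Hv]; first exact: a0.
  by apply/aH; rewrite /= Hu Hv.
split=> //; split=> //; apply: (has_index_card Hz aH) => x.
by rewrite -{1}orbO; split=> /action_orbitP.
Qed.

(* With the stabilizer fixed, the orbit map is determined up to a permutation of
   [O] fixing [x0], and every such permutation occurs. *)
Lemma set_count_transitive_fiber (V : zmodType) (T : finType) (O : {set T})
    (x0 : T) (H : set V) :
  x0 \in O -> subgroups #|O| H ->
  let A := (@transitive_actions V T O x0 `&`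
            (fun a => [set v | a v x0 = x0]) @^-1` [set H])%classic in
  finite_set A /\ set_count A = (#|O|.-1)`!.
Proof.
move=> x0O [Hz Hn] A; have [h [hH hsurj]] := has_index_ord Hz Hn.
(* The numbering [h] of the cosets identifies them with [O]; the transposition moves the coset of 0
   to [x0], so that [f] is a reference orbit map based at [x0]. *)
pose t := tperm (enum_val (h 0)) x0.
pose f v := t (enum_val (h v)).
have f0 : f 0 = x0 by rewrite /f /t tpermL.
have tO x : (t x \in O) = (x \in O).
  by rewrite /t; case: tpermP => // ->; rewrite x0O (enum_valP (h 0)).
have fH : coset_map H f.
  by move=> u v; rewrite -hH; split=> [/perm_inj/enum_val_inj//|huv]; rewrite /f huv.
have fO x : x \in O <-> exists v, f v = x.
  split=> [xO|[v <-]]; last by rewrite tO; exact: enum_valP.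
  have txO : t x \in O by rewrite tO.
  have [v hv] := hsurj (enum_rank_in txO (t x)).
  by exists v; rewrite /f hv enum_rankK_in // tpermK.
pose P := [set s : {perm T} | perm_on (O :\ x0) s]%SET.
have PE s : s \in P ->
    [/\ coset_map H (s \o f), forall x, x \in O <-> exists v, (s \o f) v = x,
        (s \o f) 0 = x0 & forall x, x \notin O -> s x = x].
  rewrite inE => sP; split.
  - move=> u v; rewrite -fH; split=> [/perm_inj//|fuv]; exact: (congr1 s fuv).
  - have sO := perm_closed _ (fintype.subset_trans sP (subD1set O x0)).
    move=> x; split=> [|[v <-]]; last by rewrite /= sO; apply/fO; exists v.
    by rewrite -{1}[x](permKV s) sO => /fO[v fv]; exists v; rewrite /= fv permKV.
  - by rewrite /= f0 (out_perm sP) // !inE eqxx.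
  - by move=> x xNO; rewrite (out_perm sP) // !inE negb_and xNO orbT.
have -> : A = [set action_of_map O (s \o f) | s in [set` P]]%classic.
  apply/seteqP; split=> [a [aT /= aH]|_ [s sP <-]]; last first.
    have [sH sO s0 _] := PE s sP; have [] := action_of_mapP sH sO.
    by rewrite s0.
  have [phiH _] := transitive_stabilizer aT; rewrite aH in phiH.
  have phiO v : a v x0 \in O by rewrite (actions_on_stable _ _ aT.1).
  have sE x : x \in O -> f (xget 0 [set w | f w = x]%classic) = x.
    exact: (xget_map fO).
  (* The permutation comparing [a] with the reference: it sends [f v] to [a v x0], consistently
     because both maps have the cosets of [H] as fibers. *)
  pose s0 x := if x \in O then a (xget 0 [set w | f w = x]%classic) x0 else x.
  have s0_inj : injective s0.
    move=> x y; rewrite /s0; case: ifPn => xO; case: ifPn => yO //.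
    - by move/phiH/fH; rewrite !sE.
    - by move=> xy; rewrite -xy phiO in yO.
    - by move=> xy; rewrite xy phiO in xO.
  have sf v : perm s0_inj (f v) = a v x0.
    have fvO : f v \in O by apply/fO; exists v.
    by rewrite permE /s0 fvO; apply/phiH/fH; rewrite sE.
  exists (perm s0_inj).
    rewrite /= inE; apply/fintype.subsetP => x; rewrite !inE permE /s0.
    have [xO|_] := boolP (x \in O); last by rewrite eqxx.
    rewrite andbT; apply: contra_neq => ->.
    have : perm s0_inj (f 0) = x0 by rewrite sf; case: aT.1.
    by rewrite f0 permE /s0 x0O.
  rewrite [RHS](transitive_action_of_map aT); congr (action_of_map O _).
  by apply/funext => v; rewrite /= sf.
split; first exact/finite_image/finite_finset.
rewrite (set_count_image finite_finset).
  by rewrite set_count_fin cardsE card_perm [in RHS](cardsD1 x0 O) x0O.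
move=> s s' /set_mem sP /set_mem s'P eqss'.
have [sH sO s0 sN] := PE s sP; have [s'H s'O s'0 s'N] := PE s' s'P.
apply/permP => x; have [/fO[v <-]|xNO] := boolP (x \in O); last by rewrite sN ?s'N.
have [_ /(_ v) + _] := action_of_mapP sH sO.
by rewrite eqss' s0 -s'0; have [_ -> _] := action_of_mapP s'H s'O.
Qed.

Lemma set_count_transitive (V : zmodType) (T : finType) (O : {set T}) (x0 : T) :
  x0 \in O -> finite_set (@subgroups V #|O|) ->
  finite_set (@transitive_actions V T O x0) /\
  set_count (@transitive_actions V T O x0) =
    ((#|O|.-1)`! * set_count (@subgroups V #|O|))%N.
Proof.
move=> x0O finS; pose stab (a : V -> T -> T) := [set v | a v x0 = x0]%classic.
have stabS a : @transitive_actions V T O x0 a -> subgroups #|O| (stab a).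
  by move=> /transitive_stabilizer[].
have fibers H : subgroups #|O| H -> _ := fun HS => set_count_transitive_fiber x0O HS.
have finT : finite_set (@transitive_actions V T O x0).
  by apply: (finite_fibers finS stabS) => H /fibers[].
by split=> //; apply: (set_count_fibers finT finS stabS) => H /fibers[].
Qed.

(** * Splitting off one orbit *)

Definition action_glue (V : zmodType) (T : finType) (O : {set T})
    (p : (V -> T -> T) * (V -> T -> T)) : V -> T -> T :=
  fun v x => if x \in O then p.1 v x else p.2 v x.

Lemma action_glue_orbit (V : zmodType) (T : finType) (O S : {set T})
    (b c : V -> T -> T) (x : T) :
  actions_on O b -> actions_on (S :\: O) c ->
  actions_on (S :|: O) (action_glue O (b, c)) /\
  action_orbit (action_glue O (b, c)) x =
    if x \in O then action_orbit b x else action_orbit c x.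
Proof.
move=> bO cSO; have [b0 bD bN] := bO; have [c0 cD cN] := cSO.
have cO v y : y \notin O -> c v y \notin O.
  move=> yNO; have [ySO|yNSO] := boolP (y \in S :\: O); last by rewrite cN.
  by have := actions_on_stable v y cSO; rewrite ySO inE => /andP[].
split; first split=> [y|u v y|v y]; rewrite /action_glue /=.
- by case: ifP.
- case: ifPn => yO; first by rewrite (actions_on_stable _ _ bO) yO.
  by rewrite (negPf (cO v y yO)).
- by rewrite inE negb_or => /andP[yS /negPf yO]; rewrite yO cN // inE yO.
have [xO|/negPf xO] := boolP (x \in O); apply/setP => y;
  by apply/action_orbitP/action_orbitP => -[u <-]; exists u; rewrite xO.
Qed.

Lemma restrict_action (V : zmodType) (T : finType) (O S : {set T})
    (a : V -> T -> T) :
  actions_on S a -> (forall v x, (a v x \in O) = (x \in O)) ->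
  actions_on (S :&: O) (fun v x => if x \in O then a v x else x).
Proof.
move=> [a0 aD aN] aO; split=> [x|u v x|v x]; first by case: ifP.
  by case: ifP => xO; rewrite ?aO xO.
by rewrite inE negb_and => /orP[xS|/negPf->//]; rewrite aN // if_same.
Qed.

(** The inverse restricts an action to [O] and to its complement; both are stable because [O] is an
    orbit. *)
Lemma action_fiber_glue (V : zmodType) (T : finType) (O S : {set T}) (x0 : T) :
  x0 \in O -> O \subset S ->
  set_bij (@transitive_actions V T O x0 `*` @actions_on V T (S :\: O))%classic
    (@actions_on V T S `&` (fun a => action_orbit a x0) @^-1` [set O])%classic
    (action_glue O).
Proof.
move=> x0O OS; split.
- move=> [b c] [[/= bO borb] cSO].
  have [glS glo] := action_glue_orbit x0 bO cSO.
  by split; [move: glS; rewrite (finset.setUidPl OS)|rewrite /= glo x0O].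
- move=> [b c] [b' c'] /set_mem[/= [[_ _ bN] _] cSO] /set_mem[/= [[_ _ b'N] _] c'SO] gl.
  have glE v x := congr1 (fun a => a v x) gl.
  have [_ _ cN] := cSO; have [_ _ c'N] := c'SO.
  congr pair; apply/funext => v; apply/funext => x; have := glE v x;
    rewrite /action_glue /=; case: ifPn => xO //.
    by rewrite bN // b'N.
  by rewrite cN ?c'N // inE xO.
move=> a [aS /= aO].
have aOst v x : (a v x \in O) = (x \in O).
  have xax : a v x \in action_orbit a x by apply/action_orbitP; exists v.
  rewrite -aO; apply/idP/idP => [axO|/(action_orbit_eq aS) <-//].
  rewrite -(action_orbit_eq aS axO) (action_orbit_eq aS xax).
  exact: action_orbit_refl aS.
have aOc v x : (a v x \in ~: O) = (x \in ~: O) by rewrite !inE aOst.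
exists (fun v x => if x \in O then a v x else x,
        fun v x => if x \in ~: O then a v x else x).
  split; last by have := restrict_action aS aOc; rewrite finset.setDE.
  split; first by have := restrict_action aS aOst; rewrite (finset.setIidPr OS).
  apply/setP => y; rewrite -[in RHS]aO; apply/action_orbitP/action_orbitP;
    by move=> -[v <-]; exists v; rewrite /= x0O.
apply/funext => v; apply/funext => x; rewrite /action_glue /= inE.
by case: (x \in O).
Qed.

(** [O] is a new orbit: each orbit counted for [c] contains its base point, which lies outside
    [O]. *)
Lemma card_orbits_glue (V : zmodType) (T : finType) (O S : {set T}) (x0 : T)
    (b c : V -> T -> T) :
  x0 \in O -> O \subset S -> transitive_actions O x0 b ->
  actions_on (S :\: O) c ->
  #|orbits_on S (action_glue O (b, c))| = #|orbits_on (S :\: O) c|.+1.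
Proof.
move=> x0O OS [bO borb] cSO.
have glo x := (action_glue_orbit x bO cSO).2.
have -> : orbits_on S (action_glue O (b, c)) = O |: orbits_on (S :\: O) c.
  apply/setP => Q; rewrite !inE; apply/imsetP/orP => [[x xS ->]|[/eqP->|]].
  - rewrite glo; case: ifPn => xO; last by right; apply: imset_f; rewrite inE xO.
    by left; rewrite -{1}borb in xO *; rewrite (action_orbit_eq bO xO) borb.
  - by exists x0; [exact: (fintype.subsetP OS)|rewrite glo x0O borb].
  case/imsetP => x; rewrite inE => /andP[xO xS] ->.
  by exists x => //; rewrite glo (negPf xO).
rewrite cardsU1 (_ : O \notin _) //.
apply/imsetP => -[x xSO OE]; have := action_orbit_refl x cSO.
by rewrite -OE; move: xSO; rewrite inE => /andP[/negPf->].
Qed.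

(** The [W] of the overview, for an arbitrary finite set [S] of points. *)
Definition orbit_sum (R : comUnitRingType) (V : zmodType) (T : finType)
    (y : R) (S : {set T}) : R :=
  \sum_(a \in @actions_on V T S) y ^+ #|orbits_on S a|.

Lemma orbit_sum_fiber (R : comUnitRingType) (V : zmodType) (T : finType)
    (y : R) (O S : {set T}) (x0 : T) :
  x0 \in O -> O \subset S -> finite_set (@subgroups V #|O|) ->
  finite_set (@actions_on V T (S :\: O)) ->
  let A := (@actions_on V T S `&` (fun a => action_orbit a x0) @^-1` [set O])%classic in
  finite_set A /\
  \sum_(a \in A) y ^+ #|orbits_on S a| =
  ((#|O|.-1)`! * set_count (@subgroups V #|O|))%:R *
    (y * @orbit_sum R V T y (S :\: O)).
Proof.
move=> x0O OS finS finSO A.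
have [finT cT] := set_count_transitive x0O finS.
have bijA := action_fiber_glue V x0O OS.
split.
  apply: sub_finite_set (finite_image (action_glue O) (finite_setX finT finSO)).
  by case: bijA => _ _.
rewrite (reindex_fsbig _ _ _ _ bijA) fsbig_setX //.
under eq_fsbigr => b /set_mem bT.
  rewrite (eq_fsbigr (fun c => y * y ^+ #|orbits_on (S :\: O) c|)); last first.
    by move=> c /set_mem cSO; rewrite (card_orbits_glue x0O OS bT cSO) exprS.
  rewrite fsbig_finite // -mulr_sumr -fsbig_finite // -/(orbit_sum _ _).
  over.
by rewrite fsbig_finite // big_const_seq count_predT iter_addr_0 mulr_natl -cT.
Qed.

(** Removing [x0] from [O] leaves an arbitrary subset of [S :\ x0], whose size is [k]; hence the
    shift in [G k.+1]. *)
Lemma sum_pointed_subsets (R : comUnitRingType) (T : finType) (S : {set T})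
    (x0 : T) (G : nat -> R) : x0 \in S ->
  \sum_(O : {set T} | (x0 \in O) && (O \subset S)) G #|O| =
  \sum_(k < #|S|) G k.+1 *+ 'C(#|S|.-1, k).
Proof.
move=> x0S; pose S' := S :\ x0.
have cS : #|S| = #|S'|.+1 by rewrite (cardsD1 x0) x0S.
rewrite (reindex_onto (fun B : {set T} => x0 |: B) (fun O => O :\ x0)) /=; last first.
  by move=> O /andP[x0O _]; rewrite finset.setD1K.
transitivity (\sum_(B : {set T} | B \subset S') G #|B|.+1).
  apply: eq_big => B.
    apply/andP/idP => [[/andP[_ BS] /eqP <-]|BS']; first exact: finset.setSD.
    have x0B : x0 \notin B by move: BS'; rewrite subsetD1 => /andP[].
    rewrite finset.setU1K // setU11 finset.subUset finset.sub1set x0S.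
    by rewrite (fintype.subset_trans BS') ?finset.subD1set.
  move=> /andP[_ /eqP BE]; rewrite cardsU1 (_ : x0 \notin B) // -BE.
  by rewrite !inE eqxx.
rewrite (partition_big (fun B : {set T} => inord #|B| : 'I_#|S'|.+1) xpredT) //=.
rewrite cS; apply: eq_bigr => k _.
rewrite -cards_draws -sumr_const; apply: eq_big => B.
  rewrite inE; case: (boolP (B \subset S')) => //= BS.
  by rewrite -val_eqE /= inordK // ltnS subset_leq_card.
by move=> /andP[BS /eqP <-]; rewrite inordK // ltnS subset_leq_card.
Qed.

(* The recursion for [F] reflects splitting off the orbit of a point of [S]. *)
Lemma orbit_sumE (R : comUnitRingType) (V : zmodType) (y : R) (F : fps R)
    (N : nat) :
  (forall j, finite_set (@subgroups V j)) -> F 0%N = 1 ->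
  (forall n, (0 < n <= N)%N -> F n *+ n =
     \sum_(1 <= i < n.+1) y * (set_count (@subgroups V i))%:R * F (n - i)%N) ->
  forall (T : finType) (S : {set T}), (#|S| <= N)%N ->
  finite_set (@actions_on V T S) /\ @orbit_sum R V T y S = (#|S|)`!%:R * F #|S|.
Proof.
move=> finV F0 FE T S; have [n] := ubnP #|S|; elim: n S => // n IHn S ltSn leSN.
(* On the empty set the only action is the trivial one, with no orbits, which matches [F 0 = 1]. *)
have [->|/finset.set0Pn[x0 x0S]] := eqVneq S finset.set0.
  rewrite /orbit_sum.
  have -> : @actions_on V T finset.set0 = [set (fun _ x => x)]%classic.
    apply/seteqP; split=> [a [_ _ aN]|_ -> //].
    by apply/funext => v; apply/funext => x; rewrite aN ?inE.
  split; first exact: finite_set1.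
  rewrite fsbig_set1 cards0 F0 mulr1 /orbits_on.
  by rewrite imset0 cards0.
pose B := [set O : {set T} | (x0 \in O) && (O \subset S)].
have IH (O : {set T}) : (x0 \in O) && (O \subset S) ->
    finite_set (@actions_on V T (S :\: O)) /\
    @orbit_sum R V T y (S :\: O) = (#|S| - #|O|)`!%:R * F (#|S| - #|O|)%N.
  move=> /andP[x0O OS]; have cSO : #|S :\: O| = (#|S| - #|O|)%N.
    by rewrite cardsD (finset.setIidPr OS).
  have ltSO : (#|S :\: O| < #|S|)%N.
    rewrite cSO ltn_subrL !card_gt0; apply/andP.
    by split; apply/finset.set0Pn; exists x0.
  rewrite -cSO; apply: IHn; first exact: leq_trans ltSO _.
  exact: leq_trans (ltnW ltSO) _.
have AB (a : V -> T -> T) : actions_on S a -> [set` B]%classic (action_orbit a x0).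
  move=> aS; rewrite /= inE (action_orbit_refl _ aS).
  exact: action_orbit_sub.
have fiber (O : {set T}) OB := let: conj x0O OS := andP OB in
  @orbit_sum_fiber R V T y O S x0 x0O OS (finV #|O|) (IH O OB).1.
have finA : finite_set (@actions_on V T S).
  apply: (finite_fibers (f := fun a => action_orbit a x0) _ AB) => [|O].
    exact: finite_finset.
  by rewrite /= inE => OB; have [] := fiber O OB.
split=> //; rewrite /orbit_sum.
rewrite (fsbig_fibers (f := fun a => action_orbit a x0) _ _ finA _ AB); last first.
  exact: finite_finset.
have cS_gt0 : (0 < #|S|)%N by apply/card_gt0P; exists x0.
rewrite -(bigfs _ (r := index_enum _)) ?index_enum_uniq //; last first.
  by move=> O _; rewrite mem_index_enum.
rewrite (eq_bigl (fun O : {set T} => (x0 \in O) && (O \subset S))) => [|O]; last first.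
  by rewrite -[LHS]/(O \in B) inE.
under eq_bigr => O OB do rewrite (fiber O OB).2 (IH O OB).2.
rewrite (sum_pointed_subsets (fun m =>
   (m.-1`! * set_count (@subgroups V m))%:R *
   (y * ((#|S| - m)`!%:R * F (#|S| - m)%N))) x0S).
(* The factor [#|S|] calls up the recursion [FE]; the remaining factorial is split by [bin_fact] as
   a binomial times the factorials coming from [O] and from its complement. *)
have -> : (#|S|)`!%:R = #|S|.-1`!%:R * #|S|%:R :> R.
  by rewrite -natrM -{3}(prednK cS_gt0) mulnC -factS prednK.
rewrite -[RHS]mulrA [#|S|%:R * _]mulr_natl FE ?cS_gt0 // big_add1 big_mkord mulr_sumr.
apply: eq_bigr => k _ /=.
have lek : (k <= #|S|.-1)%N by rewrite -ltnS prednK.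
rewrite -(bin_fact lek) -subn1 -subnDA add1n.
rewrite -[LHS]mulr_natl !natrM; ring.
Qed.

(** * Commuting tuples *)

(* Integer powers; the exponent is reduced modulo the order so that it becomes a
   natural number. *)
Definition expgz (gT : finGroupType) (x : gT) (z : int) : gT :=
  (x ^+ `|(z %% #[x]%g)%Z|%N)%g.

Lemma expgzn (gT : finGroupType) (x : gT) (n : nat) : expgz x n%:Z = (x ^+ n)%g.
Proof. by rewrite /expgz modz_nat absz_nat expg_mod_order. Qed.

Lemma expgzD (gT : finGroupType) (x : gT) (z w : int) :
  expgz x (z + w) = (expgz x z * expgz x w)%g.
Proof.
have absE u : `|(u %% #[x]%g)%Z|%N%:Z = (u %% #[x]%g)%Z.
  by rewrite gez0_abs // modz_ge0 // eqz_nat -lt0n order_gt0.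
rewrite -expgnDr -[RHS]expgzn PoszD !absE /expgz.
by rewrite modzDm.
Qed.

Definition commuting_tuples (r n : nat) : {pred r.-tuple 'S_n} :=
  [pred g : r.-tuple 'S_n |
     [forall i, forall j, (tnth g i * tnth g j == tnth g j * tnth g i)%g]].

Definition tuple_action (r n : nat) (g : r.-tuple 'S_n) (v : 'rV[int]_r)
    (x : 'I_n) : 'I_n :=
  (\prod_(i < r) expgz (tnth g i) (v 0 i))%g x.

Lemma tuple_action_delta (r n : nat) (g : r.-tuple 'S_n) (i : 'I_r) (x : 'I_n) :
  tuple_action g (delta_mx 0 i) x = tnth g i x.
Proof.
rewrite /tuple_action (_ : (\prod_(i < r) _)%g = tnth g i) //.
have expE j : expgz (tnth g j) ((delta_mx 0 i : 'rV[int]_r) 0 j) =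
    if j == i then tnth g j else 1%g.
  by rewrite mxE eqxx /=; case: eqP => _; rewrite (expgzn _ 1, expgzn _ 0).
under eq_bigr do rewrite expE.
by rewrite -big_mkcond big_pred1_eq.
Qed.

Lemma tuple_actionP (r n : nat) (g : r.-tuple 'S_n) :
  g \in @commuting_tuples r n -> is_Zaction (tuple_action g).
Proof.
move=> /forallP gC; split=> [x|u v x]; rewrite /tuple_action.
  rewrite big1 ?perm1 // => i _.
  by rewrite mxE (expgzn _ 0).
(* Permutations compose from left to right, so the factors for [u] and [v] appear swapped; [addrC]
   absorbs this. *)
rewrite -permM addrC -prodgM_commute => [|i j _ _].
  by congr (fun_of_perm _ x); apply: eq_bigr => i _; rewrite mxE expgzD.
by apply: commuteX2; have /forallP/(_ j)/eqP := gC i.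
Qed.

(** The vectors on which two actions agree form a subgroup, and the standard basis generates
    everything. *)
Lemma Zaction_eq (r n : nat) (a b : 'rV[int]_r -> 'I_n -> 'I_n) :
  is_Zaction a -> is_Zaction b ->
  (forall i, a (delta_mx 0 i) = b (delta_mx 0 i)) -> a = b.
Proof.
move=> [a0 aD] [b0 bD] ab; pose H := [set v | a v = b v]%classic.
have HN v : H v -> H (- v).
  move=> Hv; apply/funext => x; rewrite -[in LHS](b0 x) -(subrr v) bD.
  by rewrite -[X in a _ X]/(b v (b (- v) x)) -Hv -aD addNr a0.
have HD u v : H u -> H v -> H (u + v).
  by move=> Hu Hv; apply/funext => x; rewrite aD bD Hu Hv.
have H0 : H 0 by apply/funext => x; rewrite a0 b0.
have Hz : zmod_closed [pred x in H].
  by apply/zmod_closedE; split=> // u v Hu Hv; apply: HD => //; exact: HN.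
suff HT v : H v by apply/funext.
rewrite (row_sum_delta v); apply: (big_ind H) => // i _; rewrite -[v 0 i]intz scaler_int.
exact: zmod_closed_mulrz.
Qed.

Lemma num_commutingE (r n : nat) :
  num_commuting r n = set_count [set a | @is_Zaction r n a]%classic.
Proof.
have -> : [set a | @is_Zaction r n a]%classic =
    [set tuple_action g | g in [set` @commuting_tuples r n]]%classic.
  apply/seteqP; split=> [a [a0 aD]|_ [g gC <-]]; last exact: tuple_actionP.
  have a_inj v : injective (a v).
    by apply: (@can_inj _ _ _ (a (- v))) => x; rewrite -aD addNr a0.
  pose g := [tuple perm (a_inj (delta_mx 0 i)) | i < r].
  have gC : g \in @commuting_tuples r n.
    apply/forallP => i; apply/forallP => j; apply/eqP/permP => x.
    by rewrite !permM !tnth_mktuple !permE -!aD addrC.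
  exists g => //; apply: Zaction_eq => // [|i]; first exact: tuple_actionP.
  by apply/funext => x; rewrite tuple_action_delta tnth_mktuple permE.
rewrite (set_count_image finite_finset) ?set_count_fin // => g h _ _ gh.
apply: eq_from_tnth => i; apply/permP => x.
by rewrite -!tuple_action_delta gh.
Qed.

(** * Generating functions *)

(** The divisor sum in the recursion of the partial product is [y] times the subgroup count of rank
    [r.+1], by [num_subgroupsS]; so [orbit_sumE] applies with bound [J]. *)
Lemma geompow_prod_orbit_sum (R : comUnitRingType) (y : R) (r n J : nat) :
  (forall n : nat, n.+1%:R \is a @GRing.unit R) -> (n <= J)%N ->
  let P := \big[fps_mul/fps_one]_(1 <= j < J.+1)
             fps_geompow j (y * (num_subgroups r j)%:R) in
  finite_set (@actions_on 'rV[int]_r.+1 'I_n [set: 'I_n]) /\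
  n`!%:R * P n = @orbit_sum R 'rV[int]_r.+1 'I_n y [set: 'I_n].
Proof.
move=> unitR leJ P; pose V := 'rV[int]_r.+1 : zmodType.
have PE m : (0 < m <= J)%N -> P m *+ m =
    \sum_(1 <= i < m.+1) y * (set_count (@subgroups V i))%:R * P (m - i)%N.
  move=> lemJ; rewrite /P fps_geompow_prodS //.
  apply: eq_big_nat => i /andP[i_gt0 _].
  congr (_ * _); rewrite -num_subgroupsE num_subgroupsS // natr_sum mulr_sumr.
  by apply: eq_bigr => j _; rewrite natrM mulrCA mulr_natl.
have := @orbit_sumE R V y P J (@finite_subgroups_rV _) (fps_geompow_prod0 _ _) PE.
move=> /(_ 'I_n [set: 'I_n]); rewrite cardsT card_ord => /(_ leJ)[finA ->].
by split.
Qed.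

Lemma actions_onT (r n : nat) :
  @actions_on 'rV[int]_r 'I_n [set: 'I_n] = [set a | @is_Zaction r n a]%classic.
Proof.
by apply/seteqP; split=> a [a0 aD //]; split=> // v x; rewrite inE.
Qed.

Lemma num_orbitsE (r n : nat) (a : 'rV[int]_r -> 'I_n -> 'I_n) :
  num_orbits a = #|orbits_on [set: 'I_n] a|.
Proof.
rewrite /num_orbits; congr #|pred_of_set _|; apply/setP => Q.
by apply/imsetP/imsetP => -[x _ ->]; exists x.
Qed.

Lemma orbit_sum_num_actions (R : comUnitRingType) (y : R) (r n : nat) :
  finite_set (@actions_on 'rV[int]_r 'I_n [set: 'I_n]) ->
  @orbit_sum R 'rV[int]_r 'I_n y [set: 'I_n] =
  \sum_(k < n.+1) (num_actions r n k)%:R * y ^+ k.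
Proof.
rewrite /orbit_sum actions_onT => finA.
rewrite (fsbig_fibers (f := @num_orbits r n) _ _ finA (finite_II n.+1)); last first.
  by move=> a _; rewrite /= ltnS (leq_trans (leq_imset_card _ _)) ?card_ord.
rewrite -fsbig_ord; apply: eq_bigr => k _.
rewrite (eq_fsbigr (fun=> y ^+ k)) => [|a /set_mem[_ /= <-]]; last first.
  by rewrite num_orbitsE.
rewrite fsbig_finite ?big_const_seq ?count_predT ?iter_addr_0 ?mulr_natl //.
exact: finite_setIl.
Qed.

Theorem theorem1 (r : nat) (hr : (1 <= r)%N) :
  fps_is_infprod
    (fun j : nat => fps_geompow j ('X * (num_subgroups r.-1 j)%:R : {poly rat}))
    (fun n : nat => \poly_(k < n.+1) ((num_actions r n k)%:R / n`!%:R : rat))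
  /\
  fps_is_infprod
    (fun j : nat => fps_geompow j ((num_subgroups r.-1 j)%:R : rat))
    (fun n : nat => (num_commuting r n)%:R / n`!%:R : rat).
Proof.
case: r hr => // r _; rewrite -pred_Sn.
have unitfact (R : comUnitRingType) n :
    (forall n : nat, n.+1%:R \is a @GRing.unit R) -> n`!%:R \is a @GRing.unit R.
  by move=> unitR; rewrite -(prednK (fact_gt0 n)).
have unitQ n : n.+1%:R \is a @GRing.unit rat by rewrite unitfE Num.Theory.pnatr_eq0.
have unitQX n : n.+1%:R \is a @GRing.unit {poly rat}.
  by rewrite -(rmorph_nat polyC) rmorph_unit.
split=> n; exists n => J leJ.
  have [finA PE] := geompow_prod_orbit_sum 'X r unitQX leJ.
  apply: (mulrI (unitfact _ n unitQX)); rewrite PE orbit_sum_num_actions //.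
  rewrite poly_def mulr_sumr; apply: eq_bigr => k _.
  by rewrite !mulr_natl -!scaler_nat scalerA mulrnAr divrr ?unitfact.
(* The case [y = 1]: every action then has weight 1, so the orbit sum is the number of actions. *)
under eq_bigr do rewrite -[X in fps_geompow _ X]mul1r.
have [finA PE] := geompow_prod_orbit_sum 1 r unitQ leJ.
apply: (mulrI (unitfact _ n unitQ)); rewrite PE mulrC divrK ?unitfact //.
rewrite /orbit_sum fsbig_finite //.
under eq_bigr do rewrite expr1n.
by rewrite num_commutingE -actions_onT big_const_seq count_predT iter_addr_0.
Qed.
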